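(* There is a normal tiling $\mathcal{T}$ of the plane $\mathbb{R}^2$ by pairwise non-congruent convex pentagons of unit area. Moreover, $\mathcal{T}$ consists of hexagons that are dissected into three distinct pentagons of equal area; that is, there is a tiling of $\mathbb{R}^2$ by hexagons such that each of these hexagons is the union of three pairwise non-congruent pentagons of $\mathcal{T}$, and every tile of $\mathcal{T}$ arises in this way.
   Context: A tiling of $\mathbb{R}^2$ is a collection $\{T_1, T_2, \ldots\}$ of compact sets $T_i \subset \mathbb{R}^2$ (the tiles) such that the interiors of distinct tiles are disjoint and the union of all tiles equals $\mathbb{R}^2$. A tiling is normal if there are real numbers $R > r > 0$ such that (1) each tile contains some ball of radius $r$, and (2) each tile is contained in some ball of radius $R$. *)

(* Defs.v *)
(* MathComp-Analysis; the plane is R * R for a realType R. *)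
From HB Require Import structures.
From mathcomp Require Import all_boot all_order all_algebra.
From mathcomp Require Import all_classical all_reals all_analysis.
Set Implicit Arguments.
Unset Strict Implicit.
Unset Printing Implicit Defensive.
Import Order.TTheory GRing.Theory Num.Theory numFieldNormedType.Exports.
Local Open Scope classical_set_scope.
Local Open Scope ring_scope.

Section PlaneGeometry.
Context {R : realType}.
Implicit Types (p q a b c : R * R) (A B P : set (R * R)) (T : set (set (R * R))).

(* The library norm on R * R is the sup norm, so Euclidean distance and
   Euclidean balls are defined explicitly; the topologies coincide. *)
Definition eucl_dist p q : R :=
  Num.sqrt ((p.1 - q.1) ^+ 2 + (p.2 - q.2) ^+ 2).

Definition eucl_ball c (r : R) : set (R * R) := [set p | eucl_dist c p <= r].

Definition plane_isometry (f : R * R -> R * R) : Prop :=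
  forall p q, eucl_dist (f p) (f q) = eucl_dist p q.

(* Reflections are allowed, so mirror images are congruent. *)
Definition congruent A B : Prop :=
  exists f : R * R -> R * R, plane_isometry f /\ f @` A = B.

Definition area A : \bar R := (lebesgue_measure \x lebesgue_measure)%E A.

Definition frontier A : set (R * R) := closure A `\` A°.

Definition segment a b : set (R * R) :=
  [set (1 - t) *: a + t *: b | t in [set t : R | 0 <= t <= 1]].

Definition collinear a b c : Prop :=
  (b.1 - a.1) * (c.2 - a.2) = (c.1 - a.1) * (b.2 - a.2).

(* Vertices are indexed cyclically: ordS is i |-> i + 1 mod n. *)
Definition edge n (v : 'I_n -> R * R) (i : 'I_n) : set (R * R) :=
  segment (v i) (v (ordS i)).

(* A closed polygonal curve with n genuine corners, distinct edges of which
   meet at most in common endpoints. *)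
Definition simple_polygonal_curve n (v : 'I_n -> R * R) : Prop :=
  [/\ (3 <= n)%N, injective v,
      forall i j : 'I_n, i != j ->
        edge v i `&` edge v j `<=`
        [set v i; v (ordS i)] `&` [set v j; v (ordS j)]
    & forall i : 'I_n, ~ collinear (v i) (v (ordS i)) (v (ordS (ordS i)))].

(* The closed region enclosed by a simple closed polygonal curve C with n
   corners: by the Jordan curve theorem, the only compact sets with frontier C
   are C and C together with its inside, and C has empty interior. *)
Definition polygon (n : nat) P : Prop :=
  [/\ compact P, P° !=set0
    & exists v : 'I_n -> R * R, simple_polygonal_curve v /\
        frontier P = \bigcup_(i in [set: 'I_n]) edge v i].

Definition convex_polygon (n : nat) P : Prop := polygon n P /\ convex_set P.

Definition tiling T : Prop :=
  [/\ countable T,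
      forall A, T A -> compact A,
      forall A B, T A -> T B -> A <> B -> A° `&` B° = set0
    & \bigcup_(A in T) A = [set: R * R]].

Definition normal_tiling T : Prop :=
  tiling T /\
  exists r s : R, [/\ 0 < r, r < s,
    forall A, T A -> exists c, eucl_ball c r `<=` A
  & forall A, T A -> exists c, A `<=` eucl_ball c s].

Definition pairwise_noncongruent T : Prop :=
  forall A B, T A -> T B -> A <> B -> ~ congruent A B.

Definition dissected_in_three T (H P1 P2 P3 : set (R * R)) : Prop :=
  [/\ T P1 /\ T P2 /\ T P3,
      ~ congruent P1 P2, ~ congruent P1 P3, ~ congruent P2 P3
    & H = P1 `|` P2 `|` P3].

End PlaneGeometry.

(* Main.v *)
Require Import Defs.
From HB Require Import structures.
From mathcomp Require Import all_boot all_order all_algebra.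
From mathcomp Require Import all_classical all_reals all_analysis measurable_realfun.
From mathcomp Require Import ring lra zify.
Import Order.TTheory GRing.Theory Num.Theory numFieldNormedType.Exports.
Local Open Scope classical_set_scope.
Local Open Scope ring_scope.

(** The hexagon |x| <= 1, |y| <= 1, |x - y| <= 1 is an affine image of the
    regular hexagon. It has area 3, and its translates by the lattice
    {(a, b) in Z^2 : 3 divides a + b} tile the plane ([hexagons_cover],
    [hexagons_disjoint]).

    Three spokes from its centre, ending at (t - 1, -1), (1, t) and
    (-t, 1 - t) on alternate sides, cut it into three convex pentagons. In the
    affine picture the three end points have moved by the same amount along
    their sides, so the figure keeps an affine symmetry of order three: the
    three pieces have equal area, namely 1, for every t in ]0, 1[
    ([pentagon_area]). This symmetry is not an isometry, which leaves room for
    the pieces to have different diameters.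

    Congruent sets have the same diameter, and this single invariant separates
    all the tiles. For 2/5 < t < 1/2 the squared diameters of the pieces are
    5 - 2t + 2t^2, 1 + 2t + 2t^2 and 5 - 6t + 2t^2 ([pentagon_sqdiameter]):
    strictly monotone functions of t, with values in the disjoint intervals
    ]4.5, 4.52[, ]2.12, 2.5[ and ]2.5, 2.92[ ([sqdiameter_inj]). It remains
    to choose a different t for each point of the lattice, which is possible
    because the lattice is countable ([offset_inj]).

    Polygons are handled as intersections of half-planes, one for each edge.
    When every vertex lies strictly inside the half-planes of the edges that
    do not contain it, the intersection is a compact convex region bounded by
    the given polygonal curve ([convex_polygon_region]), and the triangles
    with apex at the first vertex cover it ([region_fan]), so that linear
    inequalities and bounds on distances need only be checked at the
    vertices. Areas are computed by cutting the pentagons along vertical lines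
    into trapezoids ([area_trapezoid]). *)

(** * Convex polygons as intersections of half-planes *)

Section ConvexPolygon.
Context {R : realType}.
Implicit Types (a b p q : R * R).

(** Twice the signed area of the triangle a b p: an affine function of p,
    positive to the left of the line from a to b. *)
Definition side a b p : R :=
  (b.1 - a.1) * (p.2 - a.2) - (b.2 - a.2) * (p.1 - a.1).

(** Squaring removes the root from the Euclidean distance, so that comparisons
    of distances become polynomial inequalities. *)
Definition sqdist p q : R := (p.1 - q.1) ^+ 2 + (p.2 - q.2) ^+ 2.

Lemma sqdistC p q : sqdist p q = sqdist q p.
Proof. by rewrite /sqdist; ring. Qed.

Lemma pairZ (t : R) p : t *: p = (t * p.1, t * p.2).
Proof. by case: p. Qed.

Lemma side_fst a b : side a b a = 0. Proof. by rewrite /side; ring. Qed.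
Lemma side_snd a b : side a b b = 0. Proof. by rewrite /side; ring. Qed.

Lemma side_segment a b p q (t : R) :
  side a b ((1 - t) *: p + t *: q) = (1 - t) * side a b p + t * side a b q.
Proof. by rewrite /side !pairZ /=; ring. Qed.

Lemma side_continuous a b : continuous (side a b).
Proof.
move=> p; rewrite /side.
apply: cvgB; (apply: cvgM; first exact: cvg_cst); apply: cvgB;
  try exact: cvg_cst; [exact: cvg_snd|exact: cvg_fst].
Qed.

Lemma ordS_neq n (i : 'I_n.+3) : ordS i != i.
Proof.
apply/eqP => /(congr1 val) /=; case: i => i /= hi.
have [h|h] : (i.+1 < n.+3 \/ i = n.+2)%N by lia.
  by rewrite modn_small//; lia.
by rewrite h modnn.
Qed.

Lemma ordSS_neq n (i : 'I_n.+3) : ordS (ordS i) != i.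
Proof.
apply/eqP => /(congr1 val) /=; case: i => i /= hi.
have [h|[h|h]] : (i.+2 < n.+3 \/ i.+1 = n.+2 \/ i = n.+2)%N by lia.
- by rewrite !modn_small//; lia.
- by rewrite h (@modn_small n.+2)// modnn; lia.
- by rewrite h modnn modn_small//.
Qed.

Section Region.
Context {n : nat} (v : 'I_n.+3 -> R * R).

Definition region : set (R * R) :=
  [set p | forall i, 0 <= side (v i) (v (ordS i)) p].

(** Local form of strict convexity for a polygon listed counterclockwise. It
    can be checked one pair of indices at a time. *)
Definition strictly_convex : Prop :=
  forall i j, j != i -> j != ordS i -> 0 < side (v i) (v (ordS i)) (v j).

Hypothesis cv : strictly_convex.

Lemma side_vertex_ge0 i j : 0 <= side (v i) (v (ordS i)) (v j).
Proof.
have [->|ji] := eqVneq j i; first by rewrite side_fst.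
have [->|jSi] := eqVneq j (ordS i); first by rewrite side_snd.
exact/ltW/cv.
Qed.

Lemma side_vertex_eq0 i j :
  side (v i) (v (ordS i)) (v j) = 0 -> j = i \/ j = ordS i.
Proof.
have [->|ji] := eqVneq j i; first by left.
have [->|jSi] := eqVneq j (ordS i); first by right.
by move=> h; have := cv i j ji jSi; rewrite h ltxx.
Qed.

Lemma vertices_inj : injective v.
Proof.
move=> i j vij.
have [//|ji] : j = i \/ j = ordS i.
  by apply: side_vertex_eq0; rewrite -vij side_fst.
have [//|ij] : i = j \/ i = ordS j.
  by apply: side_vertex_eq0; rewrite vij side_fst.
by have := ordSS_neq _ i; rewrite -ji -ij eqxx.
Qed.

Lemma side_edge_eq0 i p : edge v i p -> side (v i) (v (ordS i)) p = 0.
Proof.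
by case=> t _ <-; rewrite side_segment side_fst side_snd !mulr0 addr0.
Qed.

Lemma edge_sub_region i : edge v i `<=` region.
Proof.
move=> p [t /= /andP[t0 t1] <-] j.
rewrite side_segment; apply: addr_ge0; apply: mulr_ge0 => //.
- by rewrite subr_ge0.
- exact: side_vertex_ge0.
- exact: side_vertex_ge0.
Qed.

(** With a, b the ends of edge i, write p = (1 - t) a + t b. The half-plane of
    the preceding edge contains p only if 0 <= t, that of the following edge
    only if t <= 1. *)
Lemma region_side_eq0 i p : region p -> side (v i) (v (ordS i)) p = 0 ->
  edge v i p.
Proof.
move=> Rp p0; set z := ord_pred i.
have zi : ordS z = i by rewrite ord_predK.
have E0 : 0 < side (v z) (v i) (v (ordS i)).
  rewrite -{1}zi; apply: cv.
    by rewrite -{1}zi ordSS_neq.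
  by rewrite zi ordS_neq.
have D0 : 0 < side (v (ordS i)) (v (ordS (ordS i))) (v i).
  by apply: cv; rewrite eq_sym ?ordS_neq ?ordSS_neq.
have := Rp z; have := Rp (ordS i); rewrite zi.
set a := v i; set b := v (ordS i); set c := v (ordS _) => pc pz.
pose t := side (v z) a p / side (v z) a b.
have pE : p = (1 - t) *: a + t *: b.
  have tE : t * side (v z) a b = side (v z) a p by rewrite divfK// gt_eqF.
  (* p - a is parallel to b - a, and the factor t is read off by applying
     the linear form of the preceding edge line, which is positive at b. *)
  apply/eqP; rewrite [p]surjective_pairing !pairZ xpair_eqE /=.
  apply/andP; split; apply/eqP/(mulfI (lt0r_neq0 E0)).
    transitivity (side (v z) a b * a.1 + (t * side (v z) a b) * (b.1 - a.1)).
      apply: subr0_eq; rewrite tE -[RHS](mulr0 (- (a.1 - (v z).1))) -p0 /side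
        -/a -/b; ring.
    by ring.
  transitivity (side (v z) a b * a.2 + (t * side (v z) a b) * (b.2 - a.2)).
    apply: subr0_eq; rewrite tE -[RHS](mulr0 (- (a.2 - (v z).2))) -p0 /side -/a
      -/b; ring.
  by ring.
exists t; last by [].
rewrite /= divr_ge0 ?(ltW E0)//=.
move: pc; rewrite pE side_segment side_fst mulr0 addr0 pmulr_lge0 ?subr_ge0//.
Qed.

(** The form of edge i is nonnegative at both ends of edge j. It can vanish at
    a point strictly between them only if it vanishes at both. The ends of edge
    j would then be those of edge i, which with at least three vertices makes
    the edges equal. *)
Lemma edge_cap i j p : i != j -> edge v i p -> edge v j p ->
  [set v j; v (ordS j)] p.
Proof.
move=> ij /side_edge_eq0 + [t /= /andP[t0 t1] pE].
rewrite -pE side_segment.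
have [t00|t00] := eqVneq t 0.
  by move=> _; left; rewrite /= t00 subr0 scale1r scale0r addr0.
have [t10|t10] := eqVneq t 1.
  by move=> _; right; rewrite /= t10 subrr scale1r scale0r add0r.
have {}t0 : 0 < t by rewrite lt_neqAle eq_sym t00.
have {}t1 : 0 < 1 - t by rewrite subr_gt0 lt_neqAle t10.
move=> /eqP; rewrite paddr_eq0 ?mulr_ge0 ?(ltW t0) ?(ltW t1) ?side_vertex_ge0//.
rewrite !mulf_eq0 (gt_eqF t0) (gt_eqF t1) /= =>
  /andP[/eqP/side_vertex_eq0 h1 /eqP/side_vertex_eq0 h2].
case: h1 => h1; first by rewrite h1 eqxx in ij.
case: h2 => h2.
  by have := ordSS_neq _ i; rewrite -h1 h2 eqxx.
by rewrite h1 in h2; have := ordS_neq _ (ordS i); rewrite h2 eqxx.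
Qed.

Lemma region_simple_curve : simple_polygonal_curve v.
Proof.
split=> //; first exact: vertices_inj.
  move=> i j ij p [pi pj]; split.
    by apply: edge_cap pj pi; rewrite eq_sym.
  by apply: edge_cap pi pj.
move=> i; rewrite /collinear => h.
have := cv i (ordS (ordS i)) (ordSS_neq _ _) (ordS_neq _ _).
rewrite /side h; set x := (X in 0 < X); suff -> : x = 0 by rewrite ltxx.
by rewrite /x; ring.
Qed.

(** Seen from the first vertex, the other vertices turn counterclockwise: the
    last one that has p on its left starts an edge which, joined to the first
    vertex, spans a triangle containing p. *)
Lemma region_fan p : region p ->
  exists k : 'I_n.+3, exists x y z : R,
  [/\ 0 <= x, 0 <= y, 0 <= z, x + y + z = 1 &
      p = x *: v ord0 + y *: v k + z *: v (ordS k)].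
Proof.
move=> Rp.
(* The sign of c k tells on which side of the diagonal from vertex 0 to
   vertex k the point p lies. *)
pose c (k : nat) := side (v ord0) (v (inord k)) p.
(* The index n + 2 is left out, so that the edge from k to k + 1 never
   returns to the apex. *)
have P1 : exists k, (0 < k < n.+2)%N && (0 <= c k).
  exists 1%N => /=; have := Rp ord0; rewrite /c.
  by rewrite (_ : ordS ord0 = inord 1)//; apply: val_inj; rewrite /= inordK.
have Pb k : (0 < k < n.+2)%N && (0 <= c k) -> (k <= n.+2)%N by lia.
case: (ex_maxnP P1 Pb) => k /andP[/andP[k0 kn] ck] kmax.
have ckS : c k.+1 <= 0.
  have [kn1|kn1] := eqVneq k n.+1.
    have := Rp (inord k.+1); rewrite /c.
    rewrite (_ : ordS (inord k.+1) = ord0); last first.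
      by apply: val_inj; rewrite /= inordK ?kn1 ?modnn.
    by rewrite /side; lra.
  have kSn : (k.+1 < n.+2)%N by lia.
  rewrite leNgt; apply/negP => cS.
  have := kmax k.+1; rewrite kSn (ltW cS) ltnn; lia.
pose K : 'I_n.+3 := inord k.
have KS : ordS K = inord k.+1.
  by apply: val_inj; rewrite /= !inordK ?modn_small; lia.
have D0 : 0 < side (v K) (v (ordS K)) (v ord0).
  by apply: cv; apply/eqP => /(congr1 val); rewrite ?KS /= !inordK; lia.
have := Rp K; rewrite /c -KS -/K in ck ckS *.
set D := side (v K) (v (ordS K)) (v ord0) in D0 *.
set s := side (v K) _ p => s0.
set y := side _ _ p in ckS; set z := side _ _ p in ck.
have Dn0 := lt0r_neq0 D0.
(* Barycentric coordinates are ratios of areas. *)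
exists K, (s / D), (- y / D), (z / D); split.
- by rewrite divr_ge0// ltW.
- by rewrite divr_ge0 ?oppr_ge0// ltW.
- by rewrite divr_ge0// ltW.
- apply: (mulfI Dn0); rewrite mulr1 !mulrDr !(mulrC D) !divfK//.
  by rewrite /s /y /z /D /side; ring.
- apply/eqP; rewrite [p]surjective_pairing !pairZ xpair_eqE /=.
  apply/andP; split; apply/eqP/(mulfI Dn0).
    transitivity (s * (v ord0).1 + - y * (v K).1 + z * (v (ordS K)).1).
      by rewrite /s /y /z /D /side; ring.
    by field.
  transitivity (s * (v ord0).2 + - y * (v K).2 + z * (v (ordS K)).2).
    by rewrite /s /y /z /D /side; ring.
  by field.
Qed.

Lemma region_side_ge0 a b p : (forall j, 0 <= side a b (v j)) ->
  region p -> 0 <= side a b p.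
Proof.
move=> h /region_fan [k [x [y [z [x0 y0 z0 s1 ->]]]]].
suff -> : side a b (x *: v ord0 + y *: v k + z *: v (ordS k)) =
    x * side a b (v ord0) + y * side a b (v k) + z * side a b (v (ordS k)).
  by rewrite !addr_ge0// mulr_ge0.
have -> : x = 1 - y - z by lra.
by rewrite /side !pairZ /=; ring.
Qed.

(** The squared distance to q is a convex function. The gap in its convexity
    inequality at x A + y B + z C is
    x y |A - B|^2 + y z |B - C|^2 + x z |A - C|^2. *)
Lemma region_sqdist_le p q (D : R) :
  (forall j, sqdist (v j) q <= D) -> region p -> sqdist p q <= D.
Proof.
move=> h /region_fan [k [x [y [z [x0 y0 z0 s1 pE]]]]].
apply: (@le_trans _ _ (x * sqdist (v ord0) q + y * sqdist (v k) q
                       + z * sqdist (v (ordS k)) q)).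
  rewrite -subr_ge0.
  set A := v ord0 in pE *; set B := v k in pE *; set C := v (ordS k) in pE *.
  have -> : x * sqdist A q + y * sqdist B q + z * sqdist C q - sqdist p q
    = x * y * sqdist A B + y * z * sqdist B C + x * z * sqdist A C.
    rewrite pE; have -> : x = 1 - y - z by lra.
    by rewrite /sqdist !pairZ /=; ring.
  by rewrite !addr_ge0// !mulr_ge0// addr_ge0// sqr_ge0.
rewrite -[D]mul1r -s1 !mulrDl.
by rewrite !lerD// ler_wpM2l.
Qed.

Lemma region_closed : closed region.
Proof.
rewrite (_ : region =
  \bigcap_(i in setT) side (v i) (v (ordS i)) @^-1` [set x | 0 <= x]).
  apply: closed_bigI => i _; apply: preimage_closed; last exact: closed_ge.
  by move=> p _; exact: side_continuous.
by apply/seteqP; split => p h i; [move=> _|]; exact: h.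
Qed.

(** A point p with a vanishing form is not interior: moving away from a vertex
    where that form is positive makes it negative at once. *)
Lemma region_interior :
  region° = [set p | forall i, 0 < side (v i) (v (ordS i)) p].
Proof.
apply/seteqP; split => p.
  move=> pI i; rewrite lt_neqAle (interior_subset pI) andbT.
  apply/negP => /eqP p0; set j := ordS (ordS i).
  have vj : 0 < side (v i) (v (ordS i)) (v j).
    by apply: cv; rewrite /j ?ordSS_neq ?ordS_neq.
  (* f s = p + s (p - v j) leaves p in the direction away from v j. *)
  pose f (s : R) := (1 - s) *: p + s *: (2 *: p - v j).
  have f0 : f 0 = p by rewrite /f subr0 scale1r scale0r addr0.
  have cf : f @ (0 : R) --> f 0.
    apply: cvgD; apply: cvgZr_tmp; last exact: cvg_id.
    by apply: cvgB; [exact: cvg_cst|exact: cvg_id].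
  have : \forall s \near (0 : R), region (f s).
    by apply: cf; rewrite f0; exact: pI.
  case/nbhs_ballP => e /= e0 /(_ (e / 2)) fe.
  have : region (f (e / 2)).
    by apply: fe; rewrite /ball /= sub0r normrN gtr0_norm ?divr_gt0//; lra.
  move=> /(_ i); rewrite /f side_segment -p0 mulr0 add0r.
  rewrite (_ : side _ _ (2 *: p - v j) = - side (v i) (v (ordS i)) (v j));
    last first.
    by move: p0; rewrite /side !pairZ /=; lra.
  by rewrite mulrN oppr_ge0 leNgt mulr_gt0// divr_gt0.
move=> /= h.
apply: (@filter_forall _ _ (fun i q => 0 <= side (v i) (v (ordS i)) q)
  (nbhs p)) => i.
have : nbhs (side (v i) (v (ordS i)) p) [set x | 0 < x].
  by apply: open_nbhs_nbhs; split; [exact: open_gt | exact: h].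
move=> /(side_continuous (v i) (v (ordS i)) p) pos.
by apply: (@filterS _ (nbhs p) _ _ _ _ pos) => q /ltW.
Qed.

(** The centroid of three vertices works: an edge form vanishes at two vertices
    only. *)
Lemma region_interior_neq0 : region° !=set0.
Proof.
rewrite region_interior.
pose j1 : 'I_n.+3 := inord 1; pose j2 : 'I_n.+3 := inord 2.
exists (3^-1 *: v ord0 + 3^-1 *: v j1 + 3^-1 *: v j2) => i /=.
rewrite (_ : side _ _ _ = 3^-1 * (side (v i) (v (ordS i)) (v ord0)
   + side (v i) (v (ordS i)) (v j1) + side (v i) (v (ordS i)) (v j2)));
     last first.
  by rewrite /side !pairZ /=; field.
have h0 := side_vertex_ge0 i ord0; have h1 := side_vertex_ge0 i j1.
have h2 := side_vertex_ge0 i j2.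
apply: mulr_gt0; first by rewrite invr_gt0.
have h01 := addr_ge0 h0 h1.
rewrite lt0r; apply/andP; split; last exact: addr_ge0.
rewrite (paddr_eq0 h01 h2) (paddr_eq0 h0 h1); apply/negP => /andP[/andP[]].
move=> /eqP/side_vertex_eq0 e0 /eqP/side_vertex_eq0 e1 /eqP/side_vertex_eq0 e2.
have d01 : ord0 <> j1 by move=> /(congr1 val); rewrite /= inordK.
have d02 : ord0 <> j2 by move=> /(congr1 val); rewrite /= inordK.
have d12 : j1 <> j2 by move=> /(congr1 val); rewrite /= !inordK.
by case: e0 => e0; case: e1 => e1; case: e2 => e2;
  (try by apply: d01; rewrite e0 e1); (try by apply: d02; rewrite e0 e2);
  apply: d12; rewrite e1 e2.
Qed.

Lemma region_frontier :
  frontier region = \bigcup_(i in [set: 'I_n.+3]) edge v i.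
Proof.
rewrite /frontier -(proj1 (closure_id _) region_closed) region_interior.
apply/seteqP; split => p.
  move=> [Rp] /existsNP[i /negP]; rewrite -leNgt => pi.
  by exists i => //; apply: region_side_eq0 => //; apply/eqP;
    rewrite eq_le pi Rp.
move=> [i _ pi]; split; first exact: edge_sub_region pi.
by move=> /(_ i); rewrite (side_edge_eq0 _ _ pi) ltxx.
Qed.

Lemma region_compact : compact region.
Proof.
pose D := \sum_j sqdist (v j) 0.
have D0 : 0 <= D by apply: sumr_ge0 => j _; rewrite addr_ge0 ?sqr_ge0.
have vD j : sqdist (v j) 0 <= D.
  rewrite /D (bigD1 j)//= lerDl; apply: sumr_ge0 => k _.
  by rewrite addr_ge0 ?sqr_ge0.
apply: (@subclosed_compact _ _ (`[- (D + 1), D + 1] `*` `[- (D + 1), D + 1])).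
- exact: region_closed.
- by apply: compact_setX; exact: segment_compact.
- move=> p /(region_sqdist_le p 0 D vD); rewrite /sqdist !subr0 => h.
  by split; rewrite /= in_itv /=; apply/andP; split; nra.
Qed.

Lemma region_convex : convex_set region.
Proof.
move=> p q l /set_mem Rp /set_mem Rq; apply/mem_set => i.
rewrite (_ : conv l p q = (1 - (1 - l%:num)) *: p + (1 - l%:num) *: q);
  last first.
  by rewrite subKr.
rewrite side_segment subKr; apply: addr_ge0; exact: mulr_ge0.
Qed.

Lemma convex_polygon_region : convex_polygon n.+3 region.
Proof.
split; last exact: region_convex.
split; [exact: region_compact | exact: region_interior_neq0 | exists v].
by split; [exact: region_simple_curve | exact: region_frontier].
Qed.

End Region.
End ConvexPolygon.

(** * Area of trapezoids with vertical parallel sides *)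

Section Area.
Context {R : realType}.
Implicit Types (w p : R * R).

(** Coordinates are relative to w. The flag lo says whether the left side
    belongs to the trapezoid; leaving it out makes adjacent trapezoids
    disjoint. *)
Definition trapezoid w (lo : bool) (a b l0 l1 h0 h1 : R) : set (R * R) :=
  [set p | p.1 - w.1 \in Interval (BSide lo a) (BRight b) /\
           l0 + l1 * (p.1 - w.1) <= p.2 - w.2 <= h0 + h1 * (p.1 - w.1)].

Lemma measurable_trapezoid w lo a b l0 l1 h0 h1 :
  measurable (trapezoid w lo a b l0 l1 h0 h1).
Proof.
have mf : measurable_fun setT (fun p : R * R => p.1 - w.1).
  by apply: measurable_funB => //; exact: measurable_fst.
have ms : measurable_fun setT (fun p : R * R => p.2 - w.2).
  by apply: measurable_funB => //; exact: measurable_snd.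
have maff u0 u1 : measurable_fun setT (fun p : R * R => u0 + u1 * (p.1 - w.1)).
  by apply: measurable_funD => //; apply: measurable_funM.
rewrite (_ : trapezoid _ _ _ _ _ _ _ _ =
  ((fun p : R * R => p.1 - w.1) @^-1` [set` Interval (BSide lo a) (BRight b)])
    `&`
  ((fun p => l0 + l1 * (p.1 - w.1) <= p.2 - w.2) @^-1` [set true]) `&`
  ((fun p => p.2 - w.2 <= h0 + h1 * (p.1 - w.1)) @^-1` [set true])); last first.
  apply/seteqP; split => p; rewrite /trapezoid /=.
    by move=> [? /andP[]].
  by move=> [[? ->] ->].
rewrite -[X in X `&` _ `&` _]setTI -[X in _ `&` X `&` _]setTI.
rewrite -[X in _ `&` _ `&` X]setTI.
apply: measurableI; first apply: measurableI.
- exact: mf.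
- exact: measurable_fun_ler.
- exact: measurable_fun_ler.
Qed.

Lemma affine_continuous (u g0 g1 : R) : continuous (fun x => g0 + g1 * (x - u)).
Proof.
move=> x; apply: cvgD; first exact: cvg_cst.
by apply: cvgM; [exact: cvg_cst | apply: cvgB;
  [exact: cvg_id | exact: cvg_cst]].
Qed.

#[local] Instance is_derive_parabola (u g0 g1 x : R) :
  is_derive x 1 (fun x => g0 * x + g1 / 2 * (x - u) ^+ 2) (g0 + g1 * (x - u)).
Proof.
by apply: is_derive_eq; rewrite /GRing.scale /=; field.
Qed.

Lemma parabola_continuous (u g0 g1 : R) :
  continuous (fun x => g0 * x + g1 / 2 * (x - u) ^+ 2).
Proof.
move=> x; apply/differentiable_continuous/derivable1_diffP.
exact: (@ex_derive _ _ _ _ _ _ _ (is_derive_parabola u g0 g1 x)).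
Qed.

Lemma integral_affine (a b u g0 g1 : R) : a < b ->
  (\int[lebesgue_measure]_(x in `[a, b]) (g0 + g1 * (x - u))%:E =
  ((b - a) * (g0 + g1 * ((a + b) / 2 - u)))%:E)%E.
Proof.
move=> ab.
rewrite (@continuous_FTC2 _ (fun x => g0 + g1 * (x - u))
   (fun x => g0 * x + g1 / 2 * (x - u) ^+ 2))//.
- by rewrite -EFinB; congr EFin; field.
- by apply: continuous_subspaceT => x; exact: affine_continuous.
- split.
  + by move=> x _; exact: ex_derive.
  + by apply: cvg_at_right_filter; exact: parabola_continuous.
  + by apply: cvg_at_left_filter; exact: parabola_continuous.
- by move=> x _; rewrite derive1E derive_val.
Qed.

Lemma xsection_trapezoid w lo a b l0 l1 h0 h1 x :
  xsection (trapezoid w lo a b l0 l1 h0 h1) x =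
  if x \in Interval (BSide lo (a + w.1)) (BRight (b + w.1)) then
    `[w.2 + (l0 + l1 * (x - w.1)), w.2 + (h0 + h1 * (x - w.1))]%classic
  else set0.
Proof.
have xi : (x - w.1 \in Interval (BSide lo a) (BRight b)) =
    (x \in Interval (BSide lo (a + w.1)) (BRight (b + w.1))).
  by case: lo; rewrite !in_itv /= lerBlDr ?lerBrDr ?ltrBrDr.
apply/seteqP; split => y; rewrite /xsection /= inE.
  move=> -[/= + /andP[h1' h2']]; rewrite xi => ->.
  by rewrite /= in_itv /=; apply/andP; split; lra.
case: ifPn => // xin; rewrite /= in_itv /= => /andP[h1' h2'].
split; first by rewrite -xi in xin.
by apply/andP; split => /=; lra.
Qed.

Lemma area_trapezoid w lo a b l0 l1 h0 h1 : a < b ->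
  (forall x, a <= x <= b -> l0 + l1 * x <= h0 + h1 * x) ->
  area (trapezoid w lo a b l0 l1 h0 h1) =
  ((b - a) * (h0 - l0 + (h1 - l1) * ((a + b) / 2)))%:E.
Proof.
move=> ab lh.
pose i := Interval (BSide lo (a + w.1)) (BRight (b + w.1)).
pose g x := h0 - l0 + (h1 - l1) * (x - w.1).
have section_length (x : R) :
    lebesgue_measure (xsection (trapezoid w lo a b l0 l1 h0 h1) x) =
    ((EFin \o g) \_ [set` i]) x.
  rewrite xsection_trapezoid patchE mem_setE -/i; case: ifPn => xin; last first.
    by rewrite measure0.
  have /lh lhx : a <= x - w.1 <= b.
    by move: xin; rewrite /i lerBrDr lerBlDr; case: (lo);
      rewrite in_itv //= => /andP[/ltW-> ->].
  rewrite lebesgue_measure_itv /= lte_fin /g.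
  case: ltP => hl; first by rewrite -EFinB; congr EFin; ring.
  by congr EFin; lra.
transitivity (\int[lebesgue_measure]_x ((EFin \o g) \_ [set` i]) x)%E.
  by apply: eq_integral => x _; exact: section_length.
rewrite -integral_mkcond /i.
have mg D : measurable_fun D (EFin \o g).
  apply/measurable_EFinP/measurable_funTS; apply: continuous_measurable_fun.
  exact: affine_continuous.
rewrite integral_itv_bndoo// -(@integral_itv_bndoo _ _ _ _ true false)//.
by rewrite integral_affine ?ltrD2r//; congr EFin; field.
Qed.

End Area.

(** * Diameter, congruence and inscribed balls *)

Section Diameter.
Context {R : realType}.
Implicit Types (p q : R * R) (A B : set (R * R)).

(** The supremum is required to be attained: only then do isometries
    transport it without a limiting argument. *)
Definition has_sqdiameter A (D : R) : Prop :=
  (forall p q, A p -> A q -> sqdist p q <= D) /\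
  exists p q, [/\ A p, A q & sqdist p q = D].

Lemma sqdist_ge0 p q : 0 <= sqdist p q.
Proof. by rewrite addr_ge0 ?sqr_ge0. Qed.

Lemma isometry_sqdist f p q : plane_isometry f ->
  sqdist (f p) (f q) = sqdist p q.
Proof.
move=> /(_ p q) /(congr1 (fun x => x ^+ 2)).
by rewrite /eucl_dist !sqr_sqrtr ?sqdist_ge0//; exact: sqdist_ge0.
Qed.

Lemma congruent_sqdiameter A B (D E : R) : congruent A B ->
  has_sqdiameter A D -> has_sqdiameter B E -> D = E.
Proof.
move=> [f [isof <-]] [leD [p [q [Ap Aq pqD]]]].
move=> [leE [_ [_ [[p' Ap' <-] [q' Aq' <-] pqE]]]].
apply/eqP; rewrite eq_le -{1}pqD -pqE -(isometry_sqdist f p q isof).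
rewrite (isometry_sqdist f p' q' isof) leD// andbT.
by rewrite -(isometry_sqdist f p' q' isof) pqE; apply: leE; [exists p|exists q].
Qed.

Lemma region_sqdiameter n (v : 'I_n.+3 -> R * R) (D : R) i0 j0 :
  strictly_convex v -> (forall i j, sqdist (v i) (v j) <= D) ->
  sqdist (v i0) (v j0) = D -> has_sqdiameter (region v) D.
Proof.
move=> cv leD eqD; split=> [p q Rp Rq|].
  apply: (region_sqdist_le _ cv) Rp => j; rewrite sqdistC.
  by apply: (region_sqdist_le _ cv) Rq => i; exact: leD.
by exists (v i0), (v j0); split=> // i; exact: side_vertex_ge0.
Qed.

(** Moving by at most r in each coordinate changes an edge form by at most 2r
    when the edge vector has coordinates of absolute value at most 1. *)
Lemma region_eucl_ball n (v : 'I_n.+3 -> R * R) c (r : R) :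
  (forall i, [/\ `|(v (ordS i)).1 - (v i).1| <= 1,
    `|(v (ordS i)).2 - (v i).2| <= 1
    & 2 * r <= side (v i) (v (ordS i)) c]) ->
  eucl_ball c r `<=` region v.
Proof.
move=> h p pr i; have [d1 d2 rc] := h i.
have [x1 x2] : `|p.1 - c.1| <= r /\ `|p.2 - c.2| <= r.
  have r0 : 0 <= r by exact: le_trans (sqrtr_ge0 _) pr.
  have : sqdist c p <= r ^+ 2.
    by rewrite -(sqr_sqrtr (sqdist_ge0 c p)) ler_sqr ?nnegrE ?sqrtr_ge0.
  have aux (x : R) : x ^+ 2 <= r ^+ 2 -> `|x| <= r.
    by move=> xr; rewrite -ler_sqr ?nnegrE// real_normK ?num_real.
  rewrite /sqdist => hr; have := sqr_ge0 (c.1 - p.1);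
    have := sqr_ge0 (c.2 - p.2).
  by move=> s1 s2; split; apply: aux; rewrite -sqrrN opprB; lra.
have -> : side (v i) (v (ordS i)) p = side (v i) (v (ordS i)) c
    + ((v (ordS i)).1 - (v i).1) * (p.2 - c.2)
    - ((v (ordS i)).2 - (v i).2) * (p.1 - c.1) by rewrite /side; ring.
set e1 := _ - (v i).1 in d1 *; set e2 := _ - (v i).2 in d2 *.
have : `|e1 * (p.2 - c.2)| <= r by rewrite normrM -[r]mul1r ler_pM.
have : `|e2 * (p.1 - c.1)| <= r by rewrite normrM -[r]mul1r ler_pM.
by rewrite !ler_norml; lra.
Qed.

End Diameter.

(** * A hexagon cut into three pentagons *)

Section Pieces.
Context {R : realType}.
Implicit Types (w p q : R * R) (t : R).

Definition translated n w (s : seq (R * R)) (i : 'I_n) : R * R := w + nth 0 s i.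

Definition hexagon_vertices : seq (R * R) :=
  [:: (-1, -1); (0, -1); (1, 0); (1, 1); (0, 1); (-1, 0)].

Definition hexagon w : set (R * R) :=
  region (translated 6 w hexagon_vertices).

Definition spoke t (k : 'I_3) : R * R :=
  nth 0 [:: (t - 1, -1); (1, t); (- t, 1 - t)] k.

(** Piece k lies between spokes k and k + 1. Its two outer vertices are vertices
    2k + 1 and 2k + 2 of the hexagon. *)
Definition pentagon_vertices t (k : 'I_3) : seq (R * R) :=
  [:: (0, 0); spoke t k; nth 0 hexagon_vertices k.*2.+1;
      nth 0 hexagon_vertices (k.*2.+2 %% 6); spoke t (ordS k)].

Definition pentagon w t (k : 'I_3) : set (R * R) :=
  region (translated 5 w (pentagon_vertices t k)).

Lemma side_translate w a b p : side (w + a) (w + b) p = side a b (p - w).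
Proof. by rewrite /side /=; ring. Qed.

Lemma hexagon_strictly_convex w :
  strictly_convex (translated 6 w hexagon_vertices).
Proof.
move=> i j; rewrite side_translate /translated addrC addKr.
by case: i => [[|[|[|[|[|[|i]]]]]] hi] //;
  case: j => [[|[|[|[|[|[|j]]]]]] hj] //= _ _; rewrite /side /=; lra.
Qed.

Lemma pentagon_strictly_convex w t k : 2 / 5 < t < 1 / 2 ->
  strictly_convex (translated 5 w (pentagon_vertices t k)).
Proof.
move=> /andP[t0 t1] i j; rewrite side_translate /translated addrC addKr.
case: k => [[|[|[|k]]] hk] //;
case: i => [[|[|[|[|[|i]]]]] hi] //; case: j => [[|[|[|[|[|j]]]]] hj] //= _ _;
  rewrite /side /spoke /=; nra.
Qed.

Lemma hexagonP w p : hexagon w p <->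
  [/\ -1 <= p.1 - w.1 <= 1, -1 <= p.2 - w.2 <= 1
    & -1 <= (p.1 - w.1) - (p.2 - w.2) <= 1].
Proof.
split=> [h|[/andP[a1 a2] /andP[b1 b2] /andP[c1 c2]] i].
  have H (i : nat) (i6 : (i < 6)%N) := h (Ordinal i6).
  have := H 0%N isT; have := H 1%N isT; have := H 2%N isT; have := H 3%N isT;
  have := H 4%N isT; have := H 5%N isT.
  rewrite !side_translate /side /=.
  by move=> h0 h1 h2 h3 h4 h5; split; apply/andP; split; lra.
rewrite side_translate.
by case: i => [[|[|[|[|[|[|i]]]]]] hi] //; rewrite /side /=; lra.
Qed.

(** The sign tells on which side of the line carrying spoke k the point q
    lies. *)
Definition crossing t k q : R := side 0 (spoke t k) q.

(** The three spoke vectors add up to zero. *)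
Lemma crossing_sum t k q :
  crossing t k q + crossing t (ordS k) q + crossing t (ordS (ordS k)) q = 0.
Proof.
by case: k => [[|[|[|k]]] hk] //; rewrite /crossing /side /spoke /=; ring.
Qed.

Lemma pentagon_sub_hexagon w t k : 2 / 5 < t < 1 / 2 ->
  pentagon w t k `<=` hexagon w.
Proof.
move=> tb p pp i; apply: (region_side_ge0 _ (pentagon_strictly_convex w t k tb))
  pp => j.
have {tb} /andP[t0 t1] := tb.
rewrite side_translate /translated addrC addKr.
case: k => [[|[|[|k]]] hk] //;
case: i => [[|[|[|[|[|[|i]]]]]] hi] //; case: j => [[|[|[|[|[|j]]]]] hj] //=;
  rewrite /side /spoke /=; lra.
Qed.

(** Each piece is a sector of the hexagon between consecutive spokes. This
    makes the covering of the hexagon and the disjointness of the pieces a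
    matter of the signs of three numbers with sum zero. *)
Lemma pentagonP w t k p : 2 / 5 < t < 1 / 2 ->
  pentagon w t k p <->
  [/\ hexagon w p, 0 <= crossing t k (p - w) &
    crossing t (ordS k) (p - w) <= 0].
Proof.
move=> tb; have /andP[t0 t1] := tb; split=> [pp|[/hexagonP + c1 c2 i]].
  split; first exact: pentagon_sub_hexagon pp.
    by have := pp (inord 0); rewrite side_translate /crossing /= inordK.
  have := pp (inord 4); rewrite side_translate /= inordK//= /crossing /side /=;
    lra.
move=> [/andP[x1 x2] /andP[y1 y2] /andP[d1 d2]].
rewrite side_translate; move: c1 c2; rewrite /crossing.
case: k => [[|[|[|k]]] hk] //;
case: i => [[|[|[|[|[|i]]]]] hi] //=; rewrite /side /spoke /=; nra.
Qed.

Lemma pentagon_interior w t k : 2 / 5 < t < 1 / 2 ->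
  (pentagon w t k)° `<=`
  [set p | 0 < crossing t k (p - w) /\ crossing t (ordS k) (p - w) < 0].
Proof.
move=> tb; rewrite region_interior; last exact: pentagon_strictly_convex.
move=> p pp; split.
  by have := pp (inord 0); rewrite side_translate /crossing /= inordK.
have := pp (inord 4); rewrite side_translate /= inordK//= /crossing /side /=;
  lra.
Qed.

Lemma pentagon_interior_disjoint w t k l : 2 / 5 < t < 1 / 2 -> k != l ->
  (pentagon w t k)° `&` (pentagon w t l)° = set0.
Proof.
move=> tb kl; apply/seteqP;
  split => // p [/(pentagon_interior _ _ _ tb)[a1 a2]].
move=> /(pentagon_interior _ _ _ tb)[b1 b2].
have [e|e] : l = ordS k \/ k = ordS l.
  move: kl; case: k {a1 a2} => [[|[|[|k]]] hk] //;
    case: l {b1 b2} => [[|[|[|l]]] hl] //= _;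
  by [left; apply: val_inj|right; apply: val_inj].
  by move: a2 b1; rewrite e; lra.
by move: b2 a1; rewrite e; lra.
Qed.

(** Three numbers in cyclic order with sum zero cannot all have the same strict
    sign, so one that is nonnegative is followed by one that is nonpositive. *)
Lemma hexagon_bigcup_pentagon w t : 2 / 5 < t < 1 / 2 ->
  hexagon w = \bigcup_(k in [set: 'I_3]) pentagon w t k.
Proof.
move=> tb; apply/seteqP; split=> [p hp|p [k _]];
  last exact: pentagon_sub_hexagon.
pose c k := crossing t k (p - w).
suff [k ck ckS] : exists2 k, 0 <= c k & c (ordS k) <= 0.
  by exists k => //; apply/pentagonP.
have s0 : c ord0 + c (ordS ord0) + c (ordS (ordS ord0)) = 0.
  exact: crossing_sum.
have [c0|c0] := leP 0 (c ord0).
  have [c1|c1] := leP (c (ordS ord0)) 0; first by exists ord0.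
  by exists (ordS ord0); lra.
have [c2|c2] := leP 0 (c (ordS (ordS ord0))).
  exists (ordS (ordS ord0)) => //; apply: ltW.
  by rewrite (_ : ordS _ = ord0)//; apply: val_inj.
by exists (ordS ord0); lra.
Qed.

Definition sqdiameter t (k : 'I_3) : R :=
  nth 0 [:: 5 - 2 * t + 2 * t ^+ 2; 1 + 2 * t + 2 * t ^+ 2;
    5 - 6 * t + 2 * t ^+ 2] k.

Lemma sqdist_translate w p q : sqdist (w + p) (w + q) = sqdist p q.
Proof. by rewrite /sqdist /=; ring. Qed.

Lemma pentagon_sqdiameter w t k : 2 / 5 < t < 1 / 2 ->
  has_sqdiameter (pentagon w t k) (sqdiameter t k).
Proof.
move=> tb; have /andP[t0 t1] := tb.
have le_diam i j : sqdist (translated 5 w (pentagon_vertices t k) i)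
    (translated 5 w (pentagon_vertices t k) j) <= sqdiameter t k.
  rewrite sqdist_translate.
  case: k => [[|[|[|k]]] hk] //;
  case: i => [[|[|[|[|[|i]]]]] hi] //; case: j => [[|[|[|[|[|j]]]]] hj] //=;
    rewrite /sqdist /spoke /sqdiameter /=; nra.
have cv := pentagon_strictly_convex w t k tb.
(* The vertices farthest apart are the two spoke ends in the first piece, and a
   spoke end and a corner (1, 1) or (-1, -1) in the others. *)
case: k cv le_diam => [[|[|[|k]]] hk] // cv le_diam.
- apply: (region_sqdiameter _ _ _ (inord 1) (inord 4)) => //.
  by rewrite sqdist_translate !inordK//= /sqdist /spoke /sqdiameter /=; ring.
- apply: (region_sqdiameter _ _ _ (inord 2) (inord 4)) => //.
  by rewrite sqdist_translate !inordK//= /sqdist /spoke /sqdiameter /=; ring.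
- apply: (region_sqdiameter _ _ _ (inord 1) (inord 3)) => //.
  by rewrite sqdist_translate !inordK//= /sqdist /spoke /sqdiameter /=; ring.
Qed.

(** The ranges of the three polynomials on ]2/5, 1/2[ are disjoint, and each
    polynomial is strictly monotone there. *)
Lemma sqdiameter_inj s t k l : 2 / 5 < s < 1 / 2 -> 2 / 5 < t < 1 / 2 ->
  sqdiameter s k = sqdiameter t l -> s = t /\ k = l.
Proof.
move=> /andP[s0 s1] /andP[t0 t1].
case: k => [[|[|[|k]]] hk] //; case: l => [[|[|[|l]]] hl] //;
  rewrite /sqdiameter /= => e;
  try (by exfalso; nra); (split; last exact: val_inj).
- have /eqP : (t - s) * (1 - s - t) = 0 by lra.
  by rewrite mulf_eq0 => /orP[] /eqP; lra.
- have /eqP : (t - s) * (1 + s + t) = 0 by lra.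
  by rewrite mulf_eq0 => /orP[] /eqP; lra.
- have /eqP : (t - s) * (3 - s - t) = 0 by lra.
  by rewrite mulf_eq0 => /orP[] /eqP; lra.
Qed.

Lemma pentagon_inner_ball w t k : 2 / 5 < t < 1 / 2 ->
  exists c, eucl_ball c (1 / 10) `<=` pentagon w t k.
Proof.
move=> /andP[t0 t1].
(* At these centres all edge forms are at least 1/5 for every t. *)
exists (w + nth 0 [:: (1 / 4, - (1 / 4)); (1 / 4, 1 / 2);
  (- (1 / 2), - (1 / 4))] k).
apply: region_eucl_ball => i; rewrite side_translate (addrC w) addrK.
case: k => [[|[|[|k]]] hk] //;
case: i => [[|[|[|[|[|i]]]]] hi] //=; rewrite /side /spoke /=; split;
  rewrite ?ler_norml; nra.
Qed.

Lemma pentagon_outer_ball w t k : 2 / 5 < t < 1 / 2 ->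
  pentagon w t k `<=` eucl_ball w 2.
Proof.
move=> tb p /(pentagon_sub_hexagon _ _ _ tb) /hexagonP.
move=> [/andP[x1 x2] /andP[y1 y2] _]; rewrite /eucl_ball /=.
rewrite -(@ger0_norm _ 2)// -sqrtr_sqr ler_wsqrtr//; nra.
Qed.

End Pieces.

(** * Area of the pentagons *)

Section PieceArea.
Context {R : realType}.
Implicit Types (w p : R * R) (t : R).

Lemma area_setU (A B : set (R * R)) : measurable A -> measurable B ->
  A `&` B = set0 -> area (A `|` B) = (area A + area B)%E.
Proof. by move=> mA mB AB; rewrite /area measureU. Qed.

Lemma trapezoid_disjoint w lo (a b l0 l1 h0 h1 b' c k0 k1 m0 m1 : R) :
  b <= b' ->
  trapezoid w lo a b l0 l1 h0 h1 `&` trapezoid w false b' c k0 k1 m0 m1 = set0.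
Proof.
move=> bb'; apply/seteqP; split => // p [[+ _] [+ _]].
by rewrite !in_itv /= => /andP[_ h1'] /andP[h2' _]; lra.
Qed.

(** The vertical line through the centre cuts the first two pieces into
    trapezoids. The boundary of the third one bends at abscissa t - 1 from below
    and at -t from above, whence three trapezoids. *)
Lemma pentagon_area w t k : 2 / 5 < t < 1 / 2 -> area (pentagon w t k) = 1%E.
Proof.
move=> tb; have /andP[t0 t1] := tb.
have t1_gt0 : 0 < 1 - t by lra.
have t_gt0 : 0 < t by lra.
(* The slopes of the first and third spokes. *)
pose s := (1 - t)^-1; pose u := - ((1 - t) / t).
(* Clearing denominators in comparisons with those two lines leaves
   polynomial inequalities. *)
have sl (X Y : R) : (Y <= 0 + s * X) = ((1 - t) * Y <= X).
  by rewrite add0r mulrC ler_pdivlMr// mulrC.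
have sr (X Y : R) : (0 + s * X <= Y) = (X <= (1 - t) * Y).
  by rewrite add0r mulrC ler_pdivrMr// mulrC.
have ul (X Y : R) : (Y <= 0 + u * X) = (t * Y <= - ((1 - t) * X)).
  by rewrite add0r /u mulNr mulrAC -mulNr ler_pdivlMr// mulrC.
have ur (X Y : R) : (0 + u * X <= Y) = (- ((1 - t) * X) <= t * Y).
  by rewrite add0r /u mulNr mulrAC -mulNr ler_pdivrMr// (mulrC Y).
have crossE0 hk q : crossing t (@Ordinal 3 0%N hk) q = (t - 1) * q.2 + q.1.
  by rewrite /crossing /side /spoke /=; ring.
have crossE1 hk q : crossing t (@Ordinal 3 1%N hk) q = q.2 - t * q.1.
  by rewrite /crossing /side /spoke /=; ring.
have crossE2 hk q :
    crossing t (@Ordinal 3 2%N hk) q = - t * q.2 - (1 - t) * q.1.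
  by rewrite /crossing /side /spoke /=; ring.
case: k => [[|[|[|k]]] hk] //.
- have -> : pentagon w t (Ordinal hk) =
    trapezoid w true (t - 1) 0 (-1) 0 0 s `|` trapezoid w false 0 1 (-1) 1 0 t.
    apply/seteqP; split=> p.
      move=> /(pentagonP _ _ _ _ tb)[/hexagonP[/andP[x0 x1] /andP[y0 y1]
        /andP[d0 d1]]].
      rewrite crossE0 crossE1 /= => c1 c2.
      have [X0|X0] := leP (p.1 - w.1) 0; [left|right];
        split; rewrite ?in_itv /= ?sl; apply/andP; split; nra.
    move=> h; apply/pentagonP => //; rewrite crossE0 crossE1 /=.
    case: h => -[]; rewrite in_itv /= ?sl => /andP[x0 x1] /andP[y0 y1];
     by split; [apply/hexagonP; split; apply/andP; split; nra| nra| nra].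
  rewrite area_setU; [|exact: measurable_trapezoid|exact: measurable_trapezoid|
    exact: trapezoid_disjoint].
  rewrite !area_trapezoid; [| lra | move=> x /andP[x0 x1]; nra | lra
    | move=> x /andP[x0 x1]; rewrite sl; nra].
  by rewrite -EFinD; congr EFin; rewrite /s; field; lra.
- have -> : pentagon w t (Ordinal hk) =
    trapezoid w true (- t) 0 0 u 1 1 `|` trapezoid w false 0 1 0 t 1 0.
    apply/seteqP; split=> p.
      move=> /(pentagonP _ _ _ _ tb)[/hexagonP[/andP[x0 x1] /andP[y0 y1]
        /andP[d0 d1]]].
      rewrite crossE1 crossE2 /= => c1 c2.
      have [X0|X0] := leP (p.1 - w.1) 0; [left|right];
        split; rewrite ?in_itv /= ?ur; apply/andP; split; nra.
    move=> h; apply/pentagonP => //; rewrite crossE1 crossE2 /=.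
    case: h => -[]; rewrite in_itv /= ?ur => /andP[x0 x1] /andP[y0 y1];
     by split; [apply/hexagonP; split; apply/andP; split; nra| nra| nra].
  rewrite area_setU; [|exact: measurable_trapezoid|exact: measurable_trapezoid|
    exact: trapezoid_disjoint].
  rewrite !area_trapezoid; [| lra | move=> x /andP[x0 x1]; nra | lra
    | move=> x /andP[x0 x1]; rewrite ur; nra].
  by rewrite -EFinD; congr EFin; rewrite /u; field; lra.
- have -> : pentagon w t (Ordinal hk) =
    trapezoid w true (- 1) (t - 1) (-1) 0 1 1 `|`
    (trapezoid w false (t - 1) (- t) 0 s 1 1 `|`
     trapezoid w false (- t) 0 0 s 0 u).
    apply/seteqP; split=> p.
      move=> /(pentagonP _ _ _ _ tb)[/hexagonP[/andP[x0 x1] /andP[y0 y1]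
        /andP[d0 d1]]].
      rewrite crossE2 crossE0 /= => c1 c2.
      have [X0|X0] := leP (p.1 - w.1) (t - 1); [left|right];
        last (have [X1|X1] := leP (p.1 - w.1) (- t); [left|right]);
        split; rewrite ?in_itv /= ?ul ?sr; apply/andP; split; nra.
    move=> h; apply/pentagonP => //; rewrite crossE2 crossE0 /=.
    case: h => [|[]] -[]; rewrite in_itv /= ?sr ?ul =>
      /andP[x0 x1] /andP[y0 y1];
     by split; [apply/hexagonP; split; apply/andP; split; nra| nra| nra].
  have mT := @measurable_trapezoid R.
  rewrite area_setU; [|exact: mT|by apply: measurableU; exact: mT|
    by rewrite setIUr !trapezoid_disjoint ?setU0//; lra].
  rewrite area_setU; [|exact: mT|exact: mT|exact: trapezoid_disjoint].
  rewrite !area_trapezoid; first by rewrite -!EFinD; congr EFin; rewrite /s /u;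
    field; lra.
  + lra.
  + move=> x /andP[x0 x1]; rewrite sr.
    have : 0 <= 0 + u * x by rewrite ul; nra.
    by move=> ux; apply: (@le_trans _ _ 0) => //; rewrite mulr_ge0// ltW.
  + lra.
  + by move=> x /andP[x0 x1]; rewrite sr; nra.
  + lra.
  + by move=> x /andP[x0 x1]; lra.
Qed.

End PieceArea.

(** * The lattice of hexagons and the tiles *)

Lemma countable_family (I : countType) (U : Type) (f : I -> U) :
  countable (range f).
Proof. exact: sub_countable (card_image_le _ _) (countableP _). Qed.

Section Tiling.
Context {R : realType}.
Implicit Types (p : R * R) (z : int * int) (k : 'I_3).

(** The image of this map is {(a, b) : 3 divides a + b}. *)
Definition lattice z : R * R := ((2 * z.1 + z.2)%:~R, (z.1 + 2 * z.2)%:~R).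

(** Any injection of the countable set of lattice points into ]2/5, 1/2[ would
    do. The shift by two keeps the value at most 2/5 + 1/20. *)
Definition offset z : R := 2 / 5 + (10 * (pickle z).+2%:R)^-1.

Lemma offset_bounds z : 2 / 5 < offset z < 1 / 2.
Proof.
rewrite /offset; have k2 : 2 <= (pickle z).+2%:R :> R by rewrite ler_nat.
set d := (pickle z).+2%:R in k2 *.
have d0 : 0 < 10 * d by lra.
rewrite ltrDl invr_gt0 d0 /=.
have : (10 * d)^-1 <= 20^-1 by rewrite lef_pV2 ?posrE//; lra.
by set e := _^-1; lra.
Qed.

Lemma offset_inj : injective offset.
Proof.
move=> y z /addrI /invr_inj /mulfI e.
apply: (pcan_inj (@pickleK _)).
have /eqP := e ltac:(by lra); rewrite eqr_nat => /eqP; lia.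
Qed.

(** Among the corners (a, b), (a + 1, b), (a, b + 1), (a + 1, b + 1) of the unit
    square containing p, either one of the two on the main diagonal is a lattice
    point, or both others are. The hexagon around either end of the main
    diagonal covers the square; those around the two other corners share it
    along the diagonal. *)
Lemma hexagons_cover p : exists z, hexagon (lattice z) p.
Proof.
pose a := Num.floor p.1; pose b := Num.floor p.2.
have /andP[a0 a1] := floor_itv p.1. have /andP[b0 b1] := floor_itv p.2.
rewrite -/a -/b in a0 a1 b0 b1.
rewrite !intrD /= in a1 b1.
have H (m n : int) : -1 <= p.1 - m%:~R <= 1 -> -1 <= p.2 - n%:~R <= 1 ->
   -1 <= (p.1 - m%:~R) - (p.2 - n%:~R) <= 1 ->
   (exists l : int, m + n = 3 * l) ->
   exists z, hexagon (lattice z) p.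
  move=> h1 h2 h3 [l mnl]; exists (m - l, n - l).
  have -> : lattice (m - l, n - l) = (m%:~R, n%:~R).
    by rewrite /lattice /=; congr (_%:~R, _%:~R); lia.
  exact/hexagonP.
have [l [e|[e|e]]] : exists l : int,
    a + b = 3 * l \/ a + b = 3 * l + 1 \/ a + b = 3 * l + 2.
  exists (divz (a + b) 3).
  have := divz_eq (a + b) 3; have := ltz_mod (a + b) (isT : 3 != 0 :> int).
  have := modz_ge0 (a + b) (isT : 3 != 0 :> int). lia.
- apply: (H a b); [lra|lra|lra|by exists l].
- apply: (H (a + 1) (b + 1)); rewrite ?intrD; [lra|lra|lra|exists (l + 1); lia].
- have [le_ab|lt_ab] := leP (p.2 - b%:~R) (p.1 - a%:~R).
    by apply: (H (a + 1) b); rewrite ?intrD; [lra|lra|lra|exists (l + 1); lia].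
  by apply: (H a (b + 1)); rewrite ?intrD; [lra|lra|lra|exists (l + 1); lia].
Qed.

Lemma hexagon_interior (w p : R * R) : (hexagon w)° p ->
  [/\ -1 < p.1 - w.1 < 1, -1 < p.2 - w.2 < 1
    & -1 < (p.1 - w.1) - (p.2 - w.2) < 1].
Proof.
rewrite region_interior; last exact: hexagon_strictly_convex.
move=> h; have H (i : nat) (i6 : (i < 6)%N) := h (Ordinal i6).
have := H 0%N isT; have := H 1%N isT; have := H 2%N isT; have := H 3%N isT;
have := H 4%N isT; have := H 5%N isT.
rewrite !side_translate /side /=.
by move=> h0 h1 h2 h3 h4 h5; split; apply/andP; split; lra.
Qed.

(** The difference (dx, dy) of the centres of two overlapping open hexagons has
    |dx|, |dy|, |dx - dy| < 2, and 3 divides dx + dy: only (0, 0) remains. *)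
Lemma hexagons_disjoint y z : y <> z ->
  (hexagon (lattice y))° `&` (hexagon (lattice z))° = set0.
Proof.
move=> yz; apply/seteqP; split => // p.
move=> [/hexagon_interior[/andP[a1 a2] /andP[b1 b2] /andP[c1 c2]]].
move=> /hexagon_interior[/andP[a3 a4] /andP[b3 b4] /andP[c3 c4]].
case: y z yz a1 a2 b1 b2 c1 c2 a3 a4 b3 b4 c3 c4 => m n [m' n'] yz;
  rewrite /lattice /= => *.
apply: yz.
pose dx := (2 * m + n) - (2 * m' + n'); pose dy := (m + 2 * n) - (m' + 2 * n').
have : (-2 < dx < 2) && (-2 < dy < 2) && (-2 < dx - dy < 2).
  rewrite -!(ltr_int R) /dx /dy !intrB; apply/andP; split;
    first (apply/andP; split); lra.
rewrite /dx /dy => h; congr pair; lia.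
Qed.

End Tiling.

Section Tiles.
Context {R : realType}.
Implicit Types (p : R * R) (z : int * int) (k : 'I_3).

Definition tile (x : (int * int) * 'I_3) : set (R * R) :=
  pentagon (lattice x.1) (offset x.1) x.2.

Lemma congruent_tile x y : congruent (tile x) (tile y) -> x = y.
Proof.
move=> /congruent_sqdiameter xy.
have [] := sqdiameter_inj _ _ _ _ (offset_bounds x.1) (offset_bounds y.1)
  (xy _ _ (pentagon_sqdiameter _ _ _ (offset_bounds x.1))
          (pentagon_sqdiameter _ _ _ (offset_bounds y.1))).
by case: x y {xy} => [z k] [z' k'] /= /offset_inj -> ->.
Qed.

Lemma tile_interior_disjoint x y : x <> y -> (tile x)° `&` (tile y)° = set0.
Proof.
case: x y => [z k] [z' k'] xy.
have [zz'|/eqP zz'] := eqVneq z z'.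
  rewrite /tile zz' /=; apply: pentagon_interior_disjoint;
    first exact: offset_bounds.
  by apply/eqP => kk'; apply: xy; rewrite zz' kk'.
apply/seteqP; split => // p [px py].
rewrite -(hexagons_disjoint z z' zz'); split.
  exact: interiorS (pentagon_sub_hexagon _ _ k (@offset_bounds R z)) _ px.
exact: interiorS (pentagon_sub_hexagon _ _ k' (@offset_bounds R z')) _ py.
Qed.

Lemma tile_convex_polygon x : convex_polygon 5 (tile x).
Proof.
apply: convex_polygon_region; apply: pentagon_strictly_convex.
exact: offset_bounds.
Qed.

Lemma hexagon_polygon z : polygon 6 (hexagon (lattice z) : set (R * R)).
Proof.
by have [] := convex_polygon_region _ (hexagon_strictly_convex (@lattice R z)).
Qed.

Lemma hexagon_dissected z k :
  dissected_in_three (range tile) (hexagon (lattice z))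
    (tile (z, k)) (tile (z, ordS k)) (tile (z, ordS (ordS k))).
Proof.
split.
- by split; [|split]; eexists.
- by move=> /congruent_tile[]; case: k => [[|[|[|k]]] hk].
- by move=> /congruent_tile[]; case: k => [[|[|[|k]]] hk].
- by move=> /congruent_tile[]; case: k => [[|[|[|k]]] hk].
rewrite (hexagon_bigcup_pentagon _ _ (offset_bounds z)) /tile /=; apply/seteqP; split=> p.
  move=> [l _ pl].
  have [e|[e|e]] : l = k \/ l = ordS k \/ l = ordS (ordS k).
    case: k => [[|[|[|k]]] hk] //; case: l {pl} => [[|[|[|l]]] hl] //;
    by [left; exact: val_inj|right; left; exact: val_inj|right; right;
      exact: val_inj].
  - by left; left; rewrite -e.
  - by left; right; rewrite -e.
  - by right; rewrite -e.
by move=> [[]|] pk; [exists k|exists (ordS k)|exists (ordS (ordS k))].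
Qed.

Lemma tiling_tiles : tiling (range tile).
Proof.
split.
- exact: countable_family.
- by move=> _ [x _ <-]; have [[]] := tile_convex_polygon x.
- move=> _ _ [x _ <-] [y _ <-] xy; apply: tile_interior_disjoint => e.
  by apply: xy; rewrite e.
- apply/seteqP; split => // p _; have [z] := hexagons_cover p.
  rewrite (hexagon_bigcup_pentagon _ _ (offset_bounds z)) => -[k _ pk].
  by exists (tile (z, k)) => //; exists (z, k).
Qed.

Lemma tiling_hexagons :
  tiling (range (fun z => hexagon (lattice z) : set (R * R))).
Proof.
split.
- exact: countable_family.
- by move=> _ [z _ <-]; have [] := hexagon_polygon z.
- move=> _ _ [y _ <-] [z _ <-] yz; apply: hexagons_disjoint => e.
  by apply: yz; rewrite e.
- apply/seteqP; split => // p _; have [z pz] := hexagons_cover p.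
  by exists (hexagon (lattice z)) => //; exists z.
Qed.

End Tiles.

Theorem theorem4 (R : realType) :
  exists T : set (set (R * R)),
    [/\ normal_tiling T,
        forall P, T P -> convex_polygon 5 P,
        forall P, T P -> area P = 1%E
      & pairwise_noncongruent T] /\
    exists HH : set (set (R * R)),
      [/\ tiling HH,
          forall H, HH H -> polygon 6 H,
          forall H, HH H -> exists P1 P2 P3, dissected_in_three T H P1 P2 P3
        & forall P, T P -> exists H P2 P3,
            HH H /\ dissected_in_three T H P P2 P3].
Proof.
exists (range tile); split; first split.
- split; first exact: tiling_tiles.
  exists (1 / 10), 2; split; [lra|lra|move=> _ [x _ <-]|move=> _ [x _ <-]].
    exact: pentagon_inner_ball (offset_bounds _).
  by exists (lattice x.1); apply: pentagon_outer_ball; exact: offset_bounds.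
- by move=> _ [x _ <-]; exact: tile_convex_polygon.
- by move=> _ [x _ <-]; exact: pentagon_area (offset_bounds _).
- by move=> _ _ [x _ <-] [y _ <-] xy /congruent_tile e; apply: xy; rewrite e.
exists (range (fun z => hexagon (lattice z))); split.
- exact: tiling_hexagons.
- by move=> _ [z _ <-]; exact: hexagon_polygon.
- by move=> _ [z _ <-]; do 3 eexists; exact: (hexagon_dissected z ord0).
- move=> _ [[z k] _ <-]; exists (hexagon (lattice z)).
  exists (tile (z, ordS k)), (tile (z, ordS (ordS k))); split; first by exists z.
  exact: hexagon_dissected.
Qed.
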